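(* For any SDS $K\subseteq\mathcal P(\mathcal T)$: (i) $K$ is finitely consistent if and only if $E(\mathcal W)=\{D\in\overline{\mathbf D}:\mathcal W\subseteq K_D\}\neq\emptyset$ for all finite $\mathcal W\subseteq K$; (ii) $\mathrm{cl}_{\mathrm{fin}}(K)=\bigcup_{\mathcal W\subseteq K,\ \mathcal W\text{ finite}}\ \bigcap_{D\in\overline{\mathbf D}:\ \mathcal W\subseteq K_D}K_D$; (iii) $K$ is finitely coherent if and only if $K$ is finitely consistent and $K=\bigcup_{\mathcal W\subseteq K,\ \mathcal W\text{ finite}}\ \bigcap_{D\in\overline{\mathbf D}:\ \mathcal W\subseteq K_D}K_D$.
   Context: Let $\mathcal T$ be a non-empty set (of ''things''), $\mathrm{cl}:\mathcal P(\mathcal T)\to\mathcal P(\mathcal T)$ a closure operator (extensive, monotone, idempotent), $\mathcal T_-\subseteq\mathcal T$ a set of forbidden things, $\mathcal T_+:=\mathrm{cl}(\emptyset)$, with standing assumption $\mathcal T_+\cap\mathcal T_-=\emptyset$. A coherent SDT is a $D\subseteq\mathcal T$ with $\mathrm{cl}(D)=D$ and $D\cap\mathcal T_-=\emptyset$; $\overline{\mathbf D}$ is the set of all coherent SDTs. For $\mathcal W\subseteq\mathcal P(\mathcal T)$, $\Sigma_{\mathcal W}$ is the set of maps $\sigma:\mathcal W\to\mathcal T$ with $\sigma(S)\in S$ for all $S\in\mathcal W$, and $\sigma(\mathcal W):=\{\sigma(S):S\in\mathcal W\}$. An SDS is any $K\subseteq\mathcal P(\mathcal T)$. It is finitely coherent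 if (K1) $\emptyset\notin K$; (K2) if $S_1\in K$ and $S_1\subseteq S_2\subseteq\mathcal T$ then $S_2\in K$; (K3) if $S\in K$ then $S\setminus\mathcal T_-\in K$; (K4) $\{t\}\in K$ for all $t\in\mathcal T_+$; (K5fin) for every non-empty finite $\mathcal W\subseteq K$ and every family $(t_\sigma)_{\sigma\in\Sigma_{\mathcal W}}$ with $t_\sigma\in\mathrm{cl}(\sigma(\mathcal W))$, $\{t_\sigma:\sigma\in\Sigma_{\mathcal W}\}\in K$. An SDS is finitely consistent if it is included in some finitely coherent SDS. $\mathrm{cl}_{\mathrm{fin}}(K)$ is the intersection of all finitely coherent SDSes that include $K$, which equals $\mathcal P(\mathcal T)$ if there are none. For $D\subseteq\mathcal T$ let $K_D:=\{S\subseteq\mathcal T:S\cap D\neq\emptyset\}$. For $S\subseteq\mathcal T$ let $\overline{\mathbf D}_S:=\{D\in\overline{\mathbf D}:S\cap D\neq\emptyset\}$ and for $\mathcal W\subseteq\mathcal P(\mathcal T)$ let $E(\mathcal W):=\bigcap_{S\in\mathcal W}\overline{\mathbf D}_S$ (with $E(\emptyset)=\overline{\mathbf D}$). An intersection over an empty family of $K_D$'s is taken to be $\mathcal P(\mathcal T)$. *)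

(* Defs.v *)
From mathcomp Require Import all_boot.
From mathcomp Require Import boolp classical_sets cardinality.
Set Implicit Arguments.
Unset Strict Implicit.
Unset Printing Implicit Defensive.
Local Open Scope classical_set_scope.

(* Things are the elements of a type T; Tm is the set of forbidden things. *)

Record closure_operator (T : Type) (cl : set T -> set T) : Prop :=
  ClosureOperator {
    cl_extensive : forall A, A `<=` cl A;
    cl_monotone : forall A B, A `<=` B -> cl A `<=` cl B;
    cl_idempotent : forall A, cl (cl A) = cl A }.

Definition Tplus (T : Type) (cl : set T -> set T) : set T := cl set0.

(* SDT = set of desirable things; SDS = set of desirable sets of things, a value
   of type set (set T). *)
Definition coherent_SDT (T : Type) (cl : set T -> set T) (Tm : set T) :
    set (set T) :=
  [set D | cl D = D /\ D `&` Tm = set0].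

(* In W -> T, the set of sets W is coerced to the type of its elements. *)
Definition selection (T : Type) (W : set (set T)) : set (W -> T) :=
  [set sigma : W -> T | forall S : W, (val S : set T) (sigma S)].
Arguments selection {T} W _.

(* In K5fin, families are indexed by the type of elements of selection W, and
   range sigma is the set sigma(W) of the things that sigma selects. *)
Record finitely_coherent (T : Type) (cl : set T -> set T) (Tm : set T)
    (K : set (set T)) : Prop := FinitelyCoherent {
  K1 : ~ K set0;
  K2 : forall S1 S2 : set T, K S1 -> S1 `<=` S2 -> K S2;
  K3 : forall S : set T, K S -> K (S `\` Tm);
  K4 : forall t : T, Tplus cl t -> K [set t];
  K5fin : forall W : set (set T), W !=set0 -> finite_set W -> W `<=` K ->
    forall t : selection W -> T,
      (forall sigma : selection W, cl (range (val sigma)) (t sigma)) ->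
      K (range t) }.

Definition finitely_consistent (T : Type) (cl : set T -> set T) (Tm : set T)
    (K : set (set T)) : Prop :=
  exists2 K' : set (set T), finitely_coherent cl Tm K' & K `<=` K'.

(* If no finitely coherent K' includes K, this \bigcap is the full set setT. *)
Definition cl_fin (T : Type) (cl : set T -> set T) (Tm : set T)
    (K : set (set T)) : set (set T) :=
  \bigcap_(K' in [set K' | finitely_coherent cl Tm K' /\ K `<=` K']) K'.

Definition K_of (T : Type) (D : set T) : set (set T) :=
  [set S | S `&` D !=set0].

Definition coherent_meeting (T : Type) (cl : set T -> set T) (Tm : set T)
    (S : set T) : set (set T) :=
  [set D | coherent_SDT cl Tm D /\ S `&` D !=set0].

(* The leading intersectand only matters when W is empty: it makes E(set0) the
   set of all coherent SDTs rather than setT. *)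
Definition E_of (T : Type) (cl : set T -> set T) (Tm : set T)
    (W : set (set T)) : set (set T) :=
  coherent_SDT cl Tm `&` \bigcap_(S in W) coherent_meeting cl Tm S.

(* Main.v *)
Require Import Defs.
From mathcomp Require Import all_boot.
From mathcomp Require Import boolp classical_sets cardinality.
Local Open Scope classical_set_scope.

(** For a selection [sigma] of a finite [W `<=` K'], with [K'] finitely coherent,
    [cl (range sigma)] is either a coherent SDT that meets every member of [W],
    or contains a forbidden thing. Hence, if [S] meets every coherent SDT that
    meets all members of [W], the K5fin-family can be chosen in [S `|` Tm], and
    K3 removes its forbidden part: [S] belongs to [K']. Conversely, the union
    over finite [W `<=` K] of the sets of such [S] satisfies all the axioms as
    soon as every finite [W `<=` K] has a coherent SDT meeting all its members. *)

Definition fin_natural_extension {T : Type} (cl : set T -> set T) (Tm : set T)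
    (K : set (set T)) : set (set T) :=
  \bigcup_(W in [set W | W `<=` K /\ finite_set W])
    \bigcap_(D in [set D | coherent_SDT cl Tm D /\ W `<=` K_of D]) K_of D.

Section FiniteCoherence.
Context {T : Type} {cl : set T -> set T} {Tm : set T}.
Hypothesis cl_closure : closure_operator cl.

Lemma E_ofE (W : set (set T)) :
  E_of cl Tm W = [set D | coherent_SDT cl Tm D /\ W `<=` K_of D].
Proof.
apply/seteqP; split=> D [cD WD]; split=> // S WS; first by case: (WD S WS).
by split=> //; apply: WD.
Qed.

Lemma fin_natural_extension_ge (K : set (set T)) :
  K `<=` fin_natural_extension cl Tm K.
Proof.
move=> S KS; exists [set S]; last by move=> D [_]; apply.
by split; [move=> _ -> | exact: finite_set1].
Qed.

Lemma selection_coherent_or_forbidden {W : set (set T)} {S : set T}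
    (sigma : selection W) :
  (forall D, coherent_SDT cl Tm D -> W `<=` K_of D -> K_of D S) ->
  exists t, cl (range (val sigma)) t /\ (S `|` Tm) t.
Proof.
move=> WS; set D := cl (range (val sigma)).
have sigmaP (x : W) : (val x : set T) (val sigma x).
  by have := valP sigma; rewrite inE; apply.
have [D0|/eqP/set0P[t [Dt Tmt]]] := pselect (D `&` Tm = set0); last first.
  by exists t; split=> //; right.
have [||t [St Dt]] := WS D; last by exists t; split=> //; left.
  by split=> //; apply: (cl_idempotent cl_closure).
(* [D] meets each [X] in [W] at the thing that [sigma] selects from it. *)
move=> X /mem_set WX; pose x : W := exist _ X WX.
by exists (val sigma x); split; [exact: (sigmaP x) | apply: (cl_extensive cl_closure); exists x].
Qed.

Lemma fin_natural_extension_sub {K K' : set (set T)}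
    (Tplus_Tm : Tplus cl `&` Tm = set0) :
  finitely_coherent cl Tm K' -> K `<=` K' -> fin_natural_extension cl Tm K `<=` K'.
Proof.
move=> cK' KK' S [W [WK Wfin] WS].
have {}WS D : coherent_SDT cl Tm D -> W `<=` K_of D -> K_of D S.
  by move=> cD WD; apply: WS.
have [W0|/eqP/set0P Wn0] := pselect (W = set0).
  (* K5fin says nothing about an empty [W]. There the coherent SDT [Tplus cl] has to meet [S], and
     K4 with K2 yields [S]. *)
  have [||t [St pt]] := WS (Tplus cl).
  - by split=> //; apply: (cl_idempotent cl_closure).
  - by rewrite W0.
  by apply: (K2 cK' (K4 cK' pt)) => _ ->.
have /choice[t tP] (sigma : selection W) :=
  selection_coherent_or_forbidden sigma WS.
have /(K3 cK') K't : K' (range t).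
  apply: (K5fin cK' Wn0 Wfin) => [X /WK/KK' //|sigma].
  by case: (tP sigma).
apply: (K2 cK' K't) => _ [[sigma _ <-] nTm].
by case: (tP sigma) => _ [].
Qed.

Lemma fin_natural_extension_coherent {K : set (set T)} :
  (forall W, finite_set W -> W `<=` K -> E_of cl Tm W !=set0) ->
  finitely_coherent cl Tm (fin_natural_extension cl Tm K).
Proof.
move=> EK; split.
(* By [EK] some coherent SDT takes part in the intersection for [W], and it cannot meet the empty
   set. *)
- move=> [W [WK Wfin] W0].
  have [D] := EK W Wfin WK; rewrite E_ofE => /W0.
  by case=> t [].
- move=> S1 S2 [W WP WS] S12; exists W => // D /WS[t [S1t Dt]].
  by exists t; split=> //; apply: S12.
- move=> S [W WP WS]; exists W => // D DP.
  have [t [St Dt]] := WS D DP; exists t; split=> //; split=> // Tmt.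
  by case: DP => [[_ D0] _]; have : set0 t by rewrite -D0.
(* Every coherent [D] contains [Tplus cl], since [cl set0] lies in [cl D = D]; so no member of [K]
   has to be invoked. *)
- move=> t pt; exists set0.
    by split; [exact: sub0set | exact: finite_set0].
  move=> D [[<- _] _]; exists t; split=> //.
  by apply: (cl_monotone cl_closure) pt.
move=> W _ Wfin WR t tP.
(* Each [S] in [W] has its own finite witness [V S] inside [K]. As [W] is finite, the union of these
   witnesses is again finite and serves for [range t]. *)
have /choice[V VP] (S : set T) : exists V, W S -> [/\ V `<=` K, finite_set V &
    forall D, coherent_SDT cl Tm D -> V `<=` K_of D -> K_of D S].
  have [/WR[V [VK Vfin] VS]|nWS] := pselect (W S); last by exists set0.
  by exists V => _; split=> // D cD VD; apply: VS.
exists (\bigcup_(S in W) V S).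
  split; first by move=> X [S /VP[VK _ _] /VK].
  by apply: bigcup_finite => // S /VP[].
move=> D [cD VD].
(* [D] meets every member of [W], so some selection [sigma] takes all its values in [D]. Then
   [t sigma] lies in [cl D = D], and [range t] meets [D]. *)
have /choice[s sP] (x : W) : exists u, (val x : set T) u /\ D u.
  have Wx : W (val x) by apply: set_mem; exact: valP.
  have [_ _ xD] := VP _ Wx.
  have [|u ?] := xD D cD; last by exists u.
  by move=> X VX; apply: VD; exists (val x).
have selS : s \in selection W by apply: mem_set => x; case: (sP x).
pose sigma : selection W := exist _ s selS.
exists (t sigma); split; first by exists sigma.
case: cD => <- _; apply: (cl_monotone cl_closure) (tP sigma) => _ [x _ <-].
by case: (sP x).
Qed.

Lemma finitely_consistentP (K : set (set T))
    (Tplus_Tm : Tplus cl `&` Tm = set0) :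
  finitely_consistent cl Tm K <->
  forall W, finite_set W -> W `<=` K -> E_of cl Tm W !=set0.
Proof.
split=> [[K' cK' KK'] W Wfin WK|EK]; last first.
  exists (fin_natural_extension cl Tm K); last exact: fin_natural_extension_ge.
  exact: fin_natural_extension_coherent.
have [E0|/eqP/set0P//] := pselect (E_of cl Tm W = set0).
(* With no coherent SDT for [W], the intersection is over an empty family, hence contains even
   [set0], which minimality would put into [K']. *)
exfalso; apply: (K1 cK').
apply: (fin_natural_extension_sub Tplus_Tm cK' KK').
by exists W; rewrite // -E_ofE E0 => D [].
Qed.

Lemma cl_finE (K : set (set T)) (Tplus_Tm : Tplus cl `&` Tm = set0) :
  cl_fin cl Tm K = fin_natural_extension cl Tm K.
Proof.
apply/seteqP; split=> S; last first.
  by move=> KS K' [cK' KK']; apply: (fin_natural_extension_sub Tplus_Tm cK' KK').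
have [EK|] :=
  pselect (forall W, finite_set W -> W `<=` K -> E_of cl Tm W !=set0).
  apply; split; first exact: fin_natural_extension_coherent.
  exact: fin_natural_extension_ge.
(* In the inconsistent case a single [W] with [E_of cl Tm W] empty already contributes all sets, so
   the union is the full power set. *)
move=> /existsNP[W /not_implyP[Wfin /not_implyP[WK E0]]] _.
exists W => // D DP; case: E0; exists D.
by rewrite E_ofE.
Qed.

(** A finitely coherent [K] may itself be taken as the [K'] that bounds the extension from above. *)
Lemma finitely_coherentP (K : set (set T)) (Tplus_Tm : Tplus cl `&` Tm = set0) :
  finitely_coherent cl Tm K <->
  finitely_consistent cl Tm K /\ K = fin_natural_extension cl Tm K.
Proof.
split=> [cK|[/(finitely_consistentP _ Tplus_Tm) EK ->]]; last first.
  exact: fin_natural_extension_coherent.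
split; first by exists K.
apply/seteqP; split; first exact: fin_natural_extension_ge.
exact: fin_natural_extension_sub.
Qed.

End FiniteCoherence.

Theorem theorem6 (T : Type) (cl : set T -> set T) (Tm : set T)
    (T_nonempty : [set: T] !=set0)
    (cl_closure : closure_operator cl)
    (Tplus_Tm : Tplus cl `&` Tm = set0)
    (K : set (set T)) :
  [/\ (forall W : set (set T), finite_set W -> W `<=` K ->
         E_of cl Tm W = [set D | coherent_SDT cl Tm D /\ W `<=` K_of D])
      /\ (finitely_consistent cl Tm K <->
          forall W : set (set T), finite_set W -> W `<=` K ->
            E_of cl Tm W !=set0),
      cl_fin cl Tm K =
        \bigcup_(W in [set W | W `<=` K /\ finite_set W])
          \bigcap_(D in [set D | coherent_SDT cl Tm D /\ W `<=` K_of D]) K_of D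
    & finitely_coherent cl Tm K <->
        finitely_consistent cl Tm K /\
        K = \bigcup_(W in [set W | W `<=` K /\ finite_set W])
          \bigcap_(D in [set D | coherent_SDT cl Tm D /\ W `<=` K_of D]) K_of D].
Proof.
split; last 1 first.
- exact: finitely_coherentP.
- split; first by move=> W _ _; exact: E_ofE.
  exact: finitely_consistentP.
- exact: cl_finE.
Qed.
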